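(* Let $m \ge 4$. Every $(m,4)$-free set $S$ of more than $\binom{m}{2} - m + 2$ points contains an $(m,4)$-good point $s$. Moreover, this point $s$ is the left endpoint of a $3$-cap.
   Context: All point sets are finite sets in the plane in general position (no three collinear), with pairwise distinct $x$-coordinates. A set of $n$ points, listed as $(x_1,y_1),\dots,(x_n,y_n)$ with $x_1<\dots<x_n$, is an $n$-cup if $\frac{y_2-y_1}{x_2-x_1} < \frac{y_3-y_2}{x_3-x_2} < \dots < \frac{y_n-y_{n-1}}{x_n-x_{n-1}}$, and an $n$-cap if $\frac{y_2-y_1}{x_2-x_1} > \frac{y_3-y_2}{x_3-x_2} > \dots > \frac{y_n-y_{n-1}}{x_n-x_{n-1}}$. Its left (right) endpoint is the point with smallest (largest) $x$-coordinate. A set is $(n,m)$-free if it contains no $n$-cup and no $m$-cap. Given a set $S$ and $s\in S$, $s$ is called $(m,l)$-good if for every $n\ge 4$ the following holds: whenever a set $B$ with $|B|\le n-2$ is adjoined to $S$ such that $S\cup B$ contains an $(n-1)$-cup whose left endpoint is $s$ and whose right endpoint lies in $B$, then $S\cup B$ contains an $l$-cap whose two rightmost points belong to $S$, or an $m$-cup whose two leftmost points belong to $S$, or $n$ points forming a convex $n$-gon. *)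

(* Defs.v *)
From HB Require Import structures.
From mathcomp Require Import all_boot all_order all_algebra.
From mathcomp Require Import finmap reals.

Set Implicit Arguments.
Unset Strict Implicit.
Unset Printing Implicit Defensive.

Import Order.TTheory GRing.Theory Num.Theory.
Local Open Scope ring_scope.

Definition collinear (R : realType) (a b c : R * R) : Prop :=
  exists u v w : R, (u, v) != (0, 0) /\
    forall p : R * R, p \in [:: a; b; c] -> u * p.1 + v * p.2 = w.

Definition general_position (R : realType) (S : {fset R * R}) : Prop :=
  (forall a b c : R * R, a \in S -> b \in S -> c \in S ->
     uniq [:: a; b; c] -> ~ collinear a b c) /\
  {in S &, injective (fun p : R * R => p.1)}.

Definition slope (R : realType) (p q : R * R) : R :=
  (q.2 - p.2) / (q.1 - p.1).

(* [:: slope p1 p2; slope p2 p3; ...] for p = [:: p1; p2; p3; ...] *)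
Definition slopes (R : realType) (p : seq (R * R)) : seq R :=
  [seq slope e.1 e.2 | e <- zip p (behead p)].

(* Cups and caps are represented by their listing in order of increasing
   x-coordinate, so the head and the last element of the list are the left and
   right endpoints. *)
Definition is_cup (R : realType) (n : nat) (p : seq (R * R)) : Prop :=
  [/\ size p = n,
      sorted (fun a b : R * R => a.1 < b.1) p
    & sorted (fun x y : R => x < y) (slopes p)].

Definition is_cap (R : realType) (n : nat) (p : seq (R * R)) : Prop :=
  [/\ size p = n,
      sorted (fun a b : R * R => a.1 < b.1) p
    & sorted (fun x y : R => x > y) (slopes p)].

Definition cup_cap_free (R : realType) (n m : nat) (S : {fset R * R}) : Prop :=
  (forall p : seq (R * R), {subset p <= S} -> ~ is_cup n p) /\
  (forall p : seq (R * R), {subset p <= S} -> ~ is_cap m p).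

Definition in_convex_hull (R : realType) (Q : {fset R * R}) (p : R * R) : Prop :=
  exists w : R * R -> R,
    [/\ forall q : R * R, q \in Q -> 0 <= w q,
        \sum_(q <- Q) w q = 1,
        \sum_(q <- Q) w q * q.1 = p.1
      & \sum_(q <- Q) w q * q.2 = p.2].

(* The points of Q are the vertices of a convex #|Q|-gon. *)
Definition convex_position (R : realType) (Q : {fset R * R}) : Prop :=
  forall q : R * R, q \in Q -> ~ in_convex_hull (Q `\ q)%fset q.

(* Adjoining B means adding points not already in S; the enlarged set S `|` B
   is subject to the same standing assumptions as S. *)
Definition good (R : realType) (m l : nat) (S : {fset R * R}) (s : R * R) : Prop :=
  s \in S /\
  forall (n : nat) (B : {fset R * R}),
    (4 <= n)%N -> (#|` B| <= n - 2)%N ->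
    [disjoint S & B]%fset -> general_position (S `|` B)%fset ->
    (exists t : seq (R * R),
       [/\ is_cup n.-1 (s :: t), {subset s :: t <= (S `|` B)%fset} & last s t \in B]) ->
    [\/ exists p : seq (R * R),
          [/\ is_cap l p, {subset p <= (S `|` B)%fset} & {subset drop (l - 2) p <= S}],
        exists p : seq (R * R),
          [/\ is_cup m p, {subset p <= (S `|` B)%fset} & {subset take 2 p <= S}]
      | exists Q : {fset R * R},
          [/\ (Q `<=` S `|` B)%fset, #|` Q| = n & convex_position Q]].

(* Main.v *)
(* Let V be the set of left endpoints of 3-caps of S.  Since S \ V has no 3-cap,
   it is a cup, so it has at most m - 1 points, and V has more than C(m-2, 2).
   The same splitting, used inductively, shows that a set without 4-caps and
   k-cups has at most C(k, 2) points; hence V contains an (m-2)-cup ..., u, s.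
   Its right endpoint s starts a 3-cap s, p, q, and s is good: in an (n-1)-cup
   s, ..., d, c, b, the position of b and c relative to the lines sp and us
   decides which of the three configurations appears. *)
Require Import Defs.
From mathcomp Require Import all_boot all_order all_algebra.
From mathcomp Require Import finmap reals.
From mathcomp Require Import boolp.
From mathcomp Require Import ring lra zify.

Set Implicit Arguments.
Unset Strict Implicit.
Unset Printing Implicit Defensive.

Import Order.TTheory GRing.Theory Num.Theory.
Local Open Scope ring_scope.

(** * Slopes, orientation and general position *)

Section Slopes.
Variable R : realType.
Implicit Types (a b c d x y z p q s : R * R) (l t : seq (R * R)).

(* Positive exactly when a, b, c is a left turn. *)
Definition turn a b c : R :=
  (c.2 - b.2) * (b.1 - a.1) - (b.2 - a.2) * (c.1 - b.1).

Lemma lt_slope a b c d : a.1 < b.1 -> c.1 < d.1 ->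
  (slope a b < slope c d) =
  (0 < (d.2 - c.2) * (b.1 - a.1) - (b.2 - a.2) * (d.1 - c.1)).
Proof.
move=> ab cd; rewrite /slope ltr_pdivrMr ?subr_gt0 // mulrAC.
by rewrite ltr_pdivlMr ?subr_gt0 // subr_gt0.
Qed.

(** Clearing denominators turns each comparison of two sides of the triangle into the same
    determinant. Later proofs use this to pass from one pair of sides to another. *)
Lemma slope_lt_turn a b c : a.1 < b.1 -> b.1 < c.1 ->
  [/\ (slope a b < slope b c) = (0 < turn a b c),
      (slope a b < slope a c) = (0 < turn a b c)
    & (slope a c < slope b c) = (0 < turn a b c)].
Proof.
move=> ab bc; have ac := lt_trans ab bc.
by split; rewrite lt_slope // /turn; congr (0 < _); ring.
Qed.

Lemma slope_gt_turn a b c : a.1 < b.1 -> b.1 < c.1 ->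
  [/\ (slope b c < slope a b) = (turn a b c < 0),
      (slope a c < slope a b) = (turn a b c < 0)
    & (slope b c < slope a c) = (turn a b c < 0)].
Proof.
move=> ab bc; have ac := lt_trans ab bc.
by split; rewrite lt_slope // -oppr_gt0 /turn; congr (0 < _); ring.
Qed.

(** The quantity [y - k * x] is the intercept of the line of slope [k] through a point, so slope
    bounds become inequalities between values of one linear functional. *)
Lemma slope_ltE a b k : a.1 < b.1 ->
  (slope a b < k) = (b.2 - k * b.1 < a.2 - k * a.1).
Proof.
move=> ab; rewrite /slope ltr_pdivrMr ?subr_gt0 //.
by rewrite -subr_gt0 -[RHS]subr_gt0; congr (0 < _); ring.
Qed.

Lemma slope_gtE a b k : a.1 < b.1 ->
  (k < slope a b) = (a.2 - k * a.1 < b.2 - k * b.1).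
Proof.
move=> ab; rewrite /slope ltr_pdivlMr ?subr_gt0 //.
by rewrite -subr_gt0 -[RHS]subr_gt0; congr (0 < _); ring.
Qed.

Lemma general_position_sub (S S' : {fset R * R}) :
  {subset S' <= S} -> general_position S -> general_position S'.
Proof.
move=> sub [col inj]; split=> [a b c /sub aS /sub bS /sub cS|a b /sub aS /sub bS].
  exact: col.
exact: inj.
Qed.

Lemma general_position_slope (S : {fset R * R}) a b c :
  general_position S -> a \in S -> b \in S -> c \in S ->
  a.1 < b.1 -> b.1 < c.1 -> slope a b != slope b c.
Proof.
move=> [col _] aS bS cS ab bc; apply/eqP => e.
have ac := lt_trans ab bc.
apply: (col a b c) => //.
  rewrite /= !inE andbT negb_or; apply/andP; split; first apply/andP; try split;
    by apply/eqP => E; move: ab bc ac; rewrite E ltxx.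
(* The line through [b] with slope [slope a b]. *)
exists (- slope a b), 1, (b.2 - slope a b * b.1); split.
  by apply/eqP => -[_ /eqP]; rewrite oner_eq0.
have eab : slope a b * (b.1 - a.1) = b.2 - a.2.
  by rewrite /slope divfK // subr_eq0 gt_eqF.
have ebc : slope a b * (c.1 - b.1) = c.2 - b.2.
  by rewrite e /slope divfK // subr_eq0 gt_eqF.
move=> x; rewrite !inE => /or3P[] /eqP ->; lra.
Qed.

Lemma general_position_slope_lt (S : {fset R * R}) a b c :
  general_position S -> a \in S -> b \in S -> c \in S ->
  a.1 < b.1 -> b.1 < c.1 -> {slope a b < slope b c} + {slope b c < slope a b}.
Proof.
move=> gS aS bS cS ab bc.
have := general_position_slope gS aS bS cS ab bc.
by case: ltgtP => // *; [left|right].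
Qed.

(** * Cups as lists: sublists and extreme slopes *)

Lemma slopes_rcons2 l a b :
  slopes (rcons (rcons l a) b) = rcons (slopes (rcons l a)) (slope a b).
Proof.
elim: l => [//|x [|y l] IH] //; exact: (congr1 (cons (slope x y)) IH).
Qed.

Lemma sorted_rcons2 (T : Type) (r : rel T) (l : seq T) (a b : T) :
  sorted r (rcons (rcons l a) b) = sorted r (rcons l a) && r a b.
Proof. by case: l => [|x l] /=; rewrite ?andbT // rcons_path last_rcons. Qed.

(** The length is dropped so that the property passes to prefixes and suffixes, and it is boolean so
    that it can be rewritten. *)
Definition cup_seq l :=
  sorted (fun a b => a.1 < b.1) l && sorted (fun x y : R => x < y) (slopes l).

Lemma is_cupE n l : is_cup n l <-> size l = n /\ cup_seq l.
Proof.
split=> [[sz h1 h2]|[sz /andP[h1 h2]]]; last by split.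
by split; rewrite // /cup_seq h1.
Qed.

Lemma cup_seq_cons a l : cup_seq (a :: l) -> cup_seq l.
Proof.
case: l => [//|b l] /andP[/andP[_ h] k]; apply/andP; split=> //.
exact: (@path_sorted _ _ (slope a b)).
Qed.

Lemma cup_seq_rcons l a : cup_seq (rcons l a) -> cup_seq l.
Proof.
case/lastP: l => [//|l b]; rewrite /cup_seq slopes_rcons2 sorted_rcons2.
move=> /andP[/andP[-> _]]; case/lastP: (slopes _) => [//|k c].
by rewrite sorted_rcons2 => /andP[-> _].
Qed.

Lemma cup_seq_catr l k : cup_seq (l ++ k) -> cup_seq k.
Proof. by elim: l => [//|x l IH] /cup_seq_cons. Qed.

Lemma cup_seq_catl l k : cup_seq (l ++ k) -> cup_seq l.
Proof.
by elim/last_ind: k => [|k x IH]; rewrite ?cats0 // -rcons_cat => /cup_seq_rcons.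
Qed.

Lemma cup_seq_rcons3 l a b c :
  cup_seq (rcons (rcons (rcons l a) b) c) =
  [&& cup_seq (rcons (rcons l a) b), b.1 < c.1 & slope a b < slope b c].
Proof.
rewrite /cup_seq !slopes_rcons2 !sorted_rcons2; rewrite -!andbA.
by do !bool_congr.
Qed.

Lemma cup_seq_lt_head a l x : cup_seq (a :: l) -> x \in l -> a.1 < x.1.
Proof.
move=> /andP[/= + _]; rewrite path_sortedE; last by move=> ? ? ?; exact: lt_trans.
by move=> /andP[/allP h _] /h.
Qed.

Lemma cup_seq_uniq l : cup_seq l -> uniq l.
Proof.
move=> /andP[+ _]; apply: sorted_uniq => [? ? ?|?]; first exact: lt_trans.
exact: ltxx.
Qed.

Lemma cup_slope_head a b l x :
  cup_seq [:: a, b & l] -> x \in b :: l -> slope a b <= slope a x.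
Proof.
elim: l a b => [|c l IH] a b h; first by rewrite inE => /eqP ->.
rewrite inE => /predU1P[-> //|xl].
have h' := cup_seq_cons h.
have ab : a.1 < b.1 by apply: (cup_seq_lt_head h); rewrite mem_head.
have bx : b.1 < x.1 by apply: (cup_seq_lt_head h').
have [_ /=/andP[bc _]] := andP h.
have := lt_le_trans bc (IH _ _ h' xl).
by have [-> <- _] := slope_lt_turn ab bx => /ltW.
Qed.

(** Moving one point to the left makes the slope to the right endpoint [b] no larger: for
    consecutive points [c], [d], the first edge is the flattest seen from [c], so [c], [d], [b] is
    no right turn. *)
Lemma cup_slope_last l a b x :
  cup_seq (rcons (rcons l a) b) -> x \in rcons l a ->
  x.1 < b.1 /\ slope x b <= slope a b.
Proof.
elim: l x => [|c l IH] x h.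
  rewrite inE => /eqP ->; split=> //.
  by apply: (cup_seq_lt_head h); rewrite mem_head.
rewrite rcons_cons inE => /predU1P[->|]; last exact: IH (cup_seq_cons h).
have cb : c.1 < b.1.
  by apply: (cup_seq_lt_head h); rewrite mem_rcons mem_head.
split=> //.
have [d [k E]] : exists d k, rcons l a = d :: k.
  by case: l {IH h} => [|d l]; [exists a, [::]|exists d, (rcons l a)].
have [db le] : d.1 < b.1 /\ slope d b <= slope a b.
  by apply: IH; [exact: cup_seq_cons h|rewrite E mem_head].
rewrite !rcons_cons E rcons_cons in h.
apply: le_trans le.
have cd : c.1 < d.1 by apply: (cup_seq_lt_head h); rewrite mem_head.
have := cup_slope_head h (x := b); rewrite inE mem_rcons mem_head orbT => /(_ isT).
rewrite !leNgt; apply: contra.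
have [_ -> ->] := slope_gt_turn cd db => //.
Qed.

(** * Convex position of a cup, and of a cup with one point above its chord *)

(** A line through [c] whose slope lies strictly between those of the two edges at [c] supports the
    cup there. *)
Lemma cup_support l c : cup_seq l -> c \in l ->
  exists k : R, forall x, x \in l -> x != c -> c.2 - k * c.1 < x.2 - k * x.1.
Proof.
move=> h cl; case/splitPr: cl h => {l} l r h.
suff [k [kl kr]] : exists k : R, (forall x, x \in l -> x.1 < c.1 /\ slope x c < k) /\
    (forall x, x \in r -> c.1 < x.1 /\ k < slope c x).
  exists k => x; rewrite mem_cat inE => /or3P[/kl[lt]|/eqP -> /eqP //|/kr[lt]].
    by rewrite slope_ltE.
  by rewrite slope_gtE.
have hr : cup_seq (c :: r) by apply: cup_seq_catr h.
have hl : cup_seq (rcons l c).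
  by apply: (@cup_seq_catl _ r); rewrite cat_rcons.
have kr b r' k : r = b :: r' -> k < slope c b ->
    forall x, x \in r -> c.1 < x.1 /\ k < slope c x.
  move=> er kb x xr; split; first exact: cup_seq_lt_head xr.
  by apply: lt_le_trans kb _; apply: (@cup_slope_head _ _ r'); rewrite -?er.
have kl a l' k : l = rcons l' a -> slope a c < k ->
    forall x, x \in l -> x.1 < c.1 /\ slope x c < k.
  move=> el ak x xl; rewrite el in hl xl.
  by have [? le] := cup_slope_last hl xl; split=> //; apply: le_lt_trans ak.
(* An endpoint has a single edge, so any slope on the correct side of it works; at an interior point
   the mean of the two edge slopes is taken. *)
case/lastP: l h hl kl => [|l a] h hl kl; case: r h hr kr => [|b r] h hr kr.
- by exists 0; split.
- exists (slope c b - 1); split=> //; apply: kr; first by [].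
  by rewrite ltrBlDr ltrDl.
- exists (slope a c + 1); split=> //; apply: kl; first by [].
  by rewrite ltrDl.
- have ab : slope a c < slope c b.
    move: h; rewrite cat_rcons => /cup_seq_catr.
    by move=> /andP[_ /= /andP[]].
  exists ((slope a c + slope c b) / 2); split; [apply: kl|apply: kr] => //; lra.
Qed.

(** In a convex combination equal to [q], the weighted excesses of the functional over its value at
    [q] sum to zero. Each excess is positive, so all weights vanish, although they sum to 1. *)
Lemma not_in_convex_hull (Q : {fset R * R}) q (u v : R) :
  (forall x, x \in Q -> u * q.1 + v * q.2 < u * x.1 + v * x.2) ->
  ~ in_convex_hull Q q.
Proof.
move=> lt [w [w0 w1 e1 e2]].
have : \sum_(x <- Q) w x * (u * x.1 + v * x.2 - (u * q.1 + v * q.2)) = 0.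
  under eq_bigr => x _ do rewrite mulrBr mulrDr !(mulrCA (w x)).
  rewrite big_split /= big_split /= sumrN -mulr_suml w1 -!mulr_sumr e1 e2.
  ring.
move/eqP; rewrite big_seq psumr_eq0; last first.
  by move=> x xQ; rewrite mulr_ge0 ?w0 // subr_ge0 ltW // lt.
move=> /allP z; have : \sum_(x <- Q) w x = 0.
  rewrite big_seq big1 // => x xQ.
  have := z x xQ; rewrite xQ /= mulf_eq0 subr_eq0 => /orP[/eqP //|].
  by rewrite gt_eqF // lt.
by rewrite w1 => /eqP; rewrite oner_eq0.
Qed.

Lemma not_in_convex_hull_above (Q : {fset R * R}) q (k : R) :
  (forall x, x \in Q -> q.2 - k * q.1 < x.2 - k * x.1) -> ~ in_convex_hull Q q.
Proof.
move=> lt; apply: (@not_in_convex_hull _ _ (- k) 1) => x /lt.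
by rewrite !mul1r !mulNr ![- _ + _]addrC.
Qed.

Lemma cup_convex_position l : cup_seq l ->
  #|` [fset x in l]%fset| = size l /\ convex_position [fset x in l]%fset.
Proof.
move=> h; split; first by rewrite card_fseq undup_id // cup_seq_uniq.
move=> q; rewrite inE => ql; have [k kP] := cup_support h ql.
by apply: (@not_in_convex_hull_above _ _ k) => x; rewrite !inE => /andP[? /kP]; exact.
Qed.

(** The chord from [s] to the right endpoint separates [p] from the cup, and the supporting line at
    a cup point still has [p] strictly above it. *)
Lemma cup_point_convex_position s t p : cup_seq (s :: t) ->
  s.1 < p.1 -> p.1 < (last s t).1 -> slope s (last s t) < slope s p ->
  #|` p |` [fset x in s :: t]%fset|%fset = (size t).+2 /\
  convex_position (p |` [fset x in s :: t])%fset.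
Proof.
move=> h sp pb sbp; set b := last s t in pb sbp *.
have sb := lt_trans sp pb.
(* Cup points lie on or below the chord: the supporting slope at an inner point [x] separates
   [slope s x] from [slope x b]. *)
have below x : x \in s :: t ->
    x.2 - slope s b * x.1 <= s.2 - slope s b * s.1.
  rewrite inE => /predU1P[-> //|xt].
  have sx := cup_seq_lt_head h xt.
  have [->|xb] := eqVneq x b.
    by rewrite leNgt -slope_gtE // ltxx.
  have xC : x \in s :: t by rewrite inE xt orbT.
  have [k kP] := cup_support h xC.
  have sneq : s != x by apply: contraTneq sx => ->; rewrite ltxx.
  have := kP _ (mem_head _ _) sneq; rewrite -slope_ltE // => skx.
  have xltb : x.1 < b.1.
    have [t1 [t2 et]] : exists t1 t2, t = t1 ++ x :: t2.
      by case/splitPr: xt => t1 t2; exists t1, t2.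
    move: (xb) (h); rewrite /b et; case: t2 {et} => [|y t2].
      by rewrite last_cat /= eqxx.
    rewrite last_cat -cat_cons => _ /cup_seq_catr /cup_seq_lt_head; apply.
    exact: (mem_last y t2).
  have := kP b (mem_last _ _); rewrite eq_sym xb => /(_ isT).
  rewrite -slope_gtE // => kxb; have := lt_trans skx kxb.
  have [-> <- _] := slope_lt_turn sx xltb.
  by rewrite slope_ltE // => /ltW.
have pabove : s.2 - slope s b * s.1 < p.2 - slope s b * p.1.
  by rewrite -slope_gtE.
have pC : p \notin s :: t.
  by apply/negP => /below; rewrite leNgt pabove.
split.
  move: pC; rewrite cardfsU1 !inE => ->; have [-> _] := cup_convex_position h.
  by rewrite /= add1n.
move=> q; rewrite !inE => /predU1P[->|qC].
  apply: (@not_in_convex_hull _ _ (slope s b) (-1)) => x.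
  rewrite !inE => /andP[/negPf -> /= /below]; lra.
have [k kP] := cup_support h qC.
have qk x : x \in s :: t -> q.2 - k * q.1 <= x.2 - k * x.1.
  by have [->|/[swap] /kP /[apply] /ltW //] := eqVneq x q.
apply: (@not_in_convex_hull_above _ _ k) => x.
rewrite !inE => /andP[xq /predU1P[->|/kP]]; last exact.
(* If [p] were on or below the supporting line at [q], both [s] and [b] would be at least as high
   relative to slope [k], giving [slope s p <= k <= slope p b] against the right turn at [p]. *)
rewrite ltNge; apply/negP => pq.
have : slope p b < slope s p.
  by move: sbp; have [-> -> _] := slope_gt_turn sp pb.
apply/negP; rewrite -leNgt; apply: (@le_trans _ _ k).
  rewrite leNgt slope_gtE // -leNgt; apply: le_trans pq _; apply: qk.
  exact: mem_head.
rewrite leNgt slope_ltE // -leNgt; apply: le_trans pq _; apply: qk.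
exact: mem_last.
Qed.

(** * Left endpoints of 3-caps and the size of sets without 4-caps *)

Lemma is_cap4 a b c d : a.1 < b.1 -> b.1 < c.1 -> c.1 < d.1 ->
  slope b c < slope a b -> slope c d < slope b c -> is_cap 4 [:: a; b; c; d].
Proof. by move=> ab bc cd h k; split; rewrite //= ?ab ?bc ?cd ?h ?k. Qed.

Lemma is_cap3 a b c : a.1 < b.1 -> b.1 < c.1 ->
  slope b c < slope a b -> is_cap 3 [:: a; b; c].
Proof. by move=> ab bc h; split; rewrite //= ?ab ?bc ?h. Qed.

Lemma seq_rcons2 (T : Type) (l : seq T) : (2 <= size l)%N ->
  exists (l' : seq T) (a b : T), l = rcons (rcons l' a) b.
Proof.
case/lastP: l => [|l b] //; case/lastP: l => [|l a] // _.
by exists l, a, b.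
Qed.

(** Boolean search over the points of [S], so that it can define a finite subset. *)
Definition starts_cap (S : {fset R * R}) x : bool :=
  has (fun p => has (fun q => [&& x.1 < p.1, p.1 < q.1 & slope p q < slope x p])
    (enum_fset S)) (enum_fset S).

Lemma starts_capP (S : {fset R * R}) x :
  reflect (exists p q, [/\ p \in S, q \in S, x.1 < p.1, p.1 < q.1
                         & slope p q < slope x p]) (starts_cap S x).
Proof.
apply: (iffP hasP) => [[p pS /hasP[q qS /and3P[]]]|[p [q [pS qS xp pq h]]]].
  by exists p, q.
by exists p => //; apply/hasP; exists q => //; rewrite xp pq.
Qed.

(** Sort [S'] by x-coordinate: by general position each consecutive triple is a cup or a cap, and
    caps are excluded, so every prefix is a cup. *)
Lemma exists_cup_of_no_cap (S S' : {fset R * R}) k :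
  general_position S -> {subset S' <= S} ->
  {in S', forall x, ~~ starts_cap S x} -> (k <= #|` S'|)%N ->
  exists l, is_cup k l /\ {subset l <= S'}.
Proof.
move=> gS sub nc kS.
pose l := sort (fun a b => a.1 <= b.1) (enum_fset S').
have lS x : x \in take k l -> x \in S'.
  by move=> /mem_take; rewrite mem_sort.
have sl : sorted (fun a b => a.1 < b.1) (take k l).
  apply: take_sorted.
  have : sorted (fun a b : R * R => a.1 <= b.1) l.
    by apply: sort_sorted => a b; exact: le_total.
  have : uniq l by rewrite sort_uniq fset_uniq.
  have : {subset l <= S} by move=> x; rewrite mem_sort => /sub.
  elim: l {lS} => [//|a [//|b l] IH] lS /andP[al ul] /andP[ab sl] /=.
  rewrite lt_neqAle ab andbT; apply/andP; split.
    apply: contraNneq al => /(proj2 gS) -> //; rewrite ?mem_head //.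
      by apply: lS; rewrite mem_head.
    by apply: lS; rewrite inE mem_head orbT.
  by apply: IH => // x xl; apply: lS; rewrite inE xl orbT.
exists (take k l); split=> //; apply/is_cupE; split.
  by rewrite size_takel // size_sort.
rewrite /cup_seq sl /=.
elim: (take k l) lS sl => [//|a [//|b [//|c r]] IH] lS /andP[ab sl].
have {}IH := IH (fun x xr => lS x (mem_behead (s := a :: _) xr)) sl.
apply/andP; split=> //.
move: (sl) => /andP[bc _].
have [aS bS cS] : [/\ a \in S', b \in S' & c \in S'].
  by split; apply: lS; rewrite !inE eqxx ?orbT.
have [//|cap] := general_position_slope_lt gS (sub _ aS) (sub _ bS) (sub _ cS) ab bc.
case/negP: (nc a aS); apply/starts_capP; exists b, c; split=> //; exact: sub.
Qed.

(** Otherwise [u], [s], [p], [q] would be a 4-cap. *)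
Lemma slope_lt_of_cap4_free (S : {fset R * R}) u s p q :
  general_position S -> (forall l, {subset l <= S} -> ~ is_cap 4 l) ->
  u \in S -> s \in S -> p \in S -> q \in S ->
  u.1 < s.1 -> s.1 < p.1 -> p.1 < q.1 -> slope p q < slope s p ->
  slope u s < slope s p.
Proof.
move=> gS free uS sS pS qS us sp pq spq.
have [//|usp] := general_position_slope_lt gS uS sS pS us sp.
case: (free [:: u; s; p; q]); last exact: is_cap4.
by move=> x; rewrite !inE => /or4P[] /eqP ->.
Qed.

Definition cap_starters (S : {fset R * R}) : {fset R * R} :=
  [fset x in S | starts_cap S x]%fset.

Lemma card_cap_starters (S : {fset R * R}) k :
  general_position S -> cup_cap_free k.+1 4 S ->
  (#|` S| <= #|` cap_starters S| + k)%N.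
Proof.
move=> gS [nocup _]; set V := cap_starters S.
have VS : (V `<=` S)%fset by apply/fsubsetP => x; rewrite !inE => /andP[].
have := cardfsID V S; rewrite (fsetIidPr VS) => <-; rewrite leq_add2l leqNgt.
apply/negP => big.
have sub : {subset (S `\` V)%fset <= S} by move=> x; rewrite !inE => /andP[].
have [|l [cl ls]] := exists_cup_of_no_cap gS sub _ big.
  by move=> x; rewrite !inE => /andP[+ xS]; rewrite xS.
by apply: (nocup l) => // x /ls /sub.
Qed.

Lemma cup_extend k l a b c : is_cup k (rcons (rcons l a) b) -> b.1 < c.1 ->
  slope a b < slope b c -> is_cup k.+1 (rcons (rcons (rcons l a) b) c).
Proof.
move=> /is_cupE[sz h] bc lt; apply/is_cupE; rewrite size_rcons sz.
by rewrite cup_seq_rcons3 h bc lt.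
Qed.

(** The right endpoint [s] of a [k]-cup of starters begins a 3-cap [s], [p], [q]; appending [p]
    yields a [k.+1]-cup of [S]. *)
Lemma cap_starters_free (S : {fset R * R}) k : (2 <= k)%N ->
  general_position S -> cup_cap_free k.+1 4 S ->
  cup_cap_free k 4 (cap_starters S).
Proof.
move=> k2 gS [nocup nocap].
have VS x : x \in cap_starters S -> x \in S by rewrite !inE => /andP[].
split=> [l lV|l lV]; last by apply: nocap => x /lV /VS.
move=> cl; have [sz _ _] := cl; rewrite -sz in k2.
have [l' [u [s el]]] := seq_rcons2 k2.
subst l.
have uV : u \in cap_starters S by apply: lV; rewrite !(mem_rcons, inE) eqxx orbT.
have sV : s \in cap_starters S by apply: lV; rewrite !(mem_rcons, inE) eqxx.
have /andP[sS /starts_capP[p [q [pS qS sp pq spq]]]] : (s \in S) && starts_cap S s.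
  by move: sV; rewrite !inE.
have us : u.1 < s.1.
  by case: cl => _; rewrite sorted_rcons2 => /andP[].
have usp := slope_lt_of_cap4_free gS nocap (VS _ uV) sS pS qS us sp pq spq.
apply: (nocup (rcons (rcons (rcons l' u) s) p)) => [x|]; last first.
  exact: cup_extend cl sp usp.
by rewrite mem_rcons inE => /predU1P[-> //|/lV /VS].
Qed.

(** Induction by Pascal's rule: passing to the starters lowers [k.+1] to [k] and loses at most [k]
    points. For [k = 2], two points already form a 2-cup. *)
Lemma card_cup_cap4_free (S : {fset R * R}) k : (2 <= k)%N ->
  general_position S -> cup_cap_free k 4 S -> (#|` S| <= 'C(k, 2))%N.
Proof.
elim: k S => [//|k IH] S; rewrite leq_eqVlt => /predU1P[[<-]|k2] gS free.
  rewrite leqNgt; apply/negP => big; have [nocup _] := free.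
  have [//|x xS|l [cl lS]] := exists_cup_of_no_cap gS _ _ big; last exact: nocup cl.
  apply/starts_capP => -[p [q [pS qS xp _ _]]].
  apply: (nocup [:: x; p]); last by split; rewrite //= xp.
  by move=> y; rewrite !inE => /orP[] /eqP ->.
have VS : {subset cap_starters S <= S} by move=> x; rewrite !inE => /andP[].
apply: leq_trans (card_cap_starters gS free) _.
rewrite binS bin1 leq_add2r; apply: IH => //.
  exact: general_position_sub VS gS.
exact: cap_starters_free.
Qed.

(** * Goodness of a point that ends a long cup and starts a 3-cap *)

Lemma good_of_cup_cap (S : {fset R * R}) m us u s p q :
  general_position S -> (forall l, {subset l <= S} -> ~ is_cap 4 l) ->
  is_cup m.+2 (rcons (rcons us u) s) -> {subset rcons (rcons us u) s <= S} ->
  p \in S -> q \in S -> s.1 < p.1 -> p.1 < q.1 -> slope p q < slope s p ->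
  good m.+4 4 S s.
Proof.
move=> gS nocap cus usS pS qS sp pq spq.
have uS : u \in S by apply: usS; rewrite !(mem_rcons, inE) eqxx orbT.
have sS : s \in S by apply: usS; rewrite !(mem_rcons, inE) eqxx.
have us_lt : u.1 < s.1 by case: cus => _; rewrite sorted_rcons2 => /andP[].
have usp := slope_lt_of_cap4_free gS nocap uS sS pS qS us_lt sp pq spq.
split=> // n B n4 _ dis gSB [t [ct tSB bB]].
have SSB x : x \in S -> x \in (S `|` B)%fset by rewrite inE => ->.
(* The caps found all end in [p], [q], which are in [S]. *)
have cap4 x y : x \in (S `|` B)%fset -> y \in (S `|` B)%fset ->
    x.1 < y.1 -> y.1 < p.1 -> slope y p < slope x y -> slope p q < slope y p ->
    exists l, [/\ is_cap 4 l, {subset l <= (S `|` B)%fset} & {subset drop (4 - 2) l <= S}].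
  move=> xS yS xy yp xyp ypq; exists [:: x; y; p; q]; split.
  - exact: is_cap4.
  - by move=> z; rewrite !in_cons orbF => /or4P[] /eqP -> //; exact: SSB.
  - by move=> z; rewrite !inE => /orP[] /eqP ->.
(* The cups found extend the given one by two points, so their two leftmost points stay in [S]. *)
have cupm x y : x \in (S `|` B)%fset -> y \in (S `|` B)%fset ->
    s.1 < x.1 -> x.1 < y.1 -> slope u s < slope s x -> slope s x < slope x y ->
    exists l, [/\ is_cup m.+4 l, {subset l <= (S `|` B)%fset} & {subset take 2 l <= S}].
  move=> xS yS sx xy usx sxy.
  exists (rcons (rcons (rcons (rcons us u) s) x) y); split.
  - by apply: cup_extend => //; apply: cup_extend.
  - move=> z; rewrite mem_rcons inE => /predU1P[-> //|].
    by rewrite mem_rcons inE => /predU1P[-> //|/usS /SSB].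
  - move=> z; rewrite -(cats1 _ y) -(cats1 _ x) !takel_cat ?size_cat ?size_rcons //.
    by move=> /mem_take /usS.
have sz : (size t).+1 = n.-1 by case: ct.
have [t0 [c [b et]]] : exists (t0 : seq (R * R)) c b, t = rcons (rcons t0 c) b.
  by apply: seq_rcons2; move: n4; rewrite -subn1 in sz; lia.
(* [d] is the predecessor of [c]; it is [s] itself when [n = 4]. *)
have [l [d el]] : exists l d, s :: t0 = rcons l d.
  by rewrite lastI; exists (belast s t0), (last s t0).
have et' : s :: t = rcons (rcons (rcons l d) c) b by rewrite et -!rcons_cons el.
have eb : last s t = b.
  by rewrite et last_rcons.
have [bS cS dS] : [/\ b \in (S `|` B)%fset, c \in (S `|` B)%fset & d \in (S `|` B)%fset].
  by split; apply: tSB; rewrite et' !(mem_rcons, inE) eqxx ?orbT.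
have [_ cupt] := (is_cupE _ _).1 ct.
have ngon l' : cup_seq l' -> size l' = n -> {subset l' <= (S `|` B)%fset} ->
    exists Q : {fset R * R}, [/\ (Q `<=` S `|` B)%fset, #|` Q| = n & convex_position Q].
  move=> cl' sl' l'S; have [cQ pQ] := cup_convex_position cl'.
  exists [fset x in l']%fset; split=> //; last by rewrite cQ.
  by apply/fsubsetP => x; rewrite in_fset => /l'S.
have ngonp t' : cup_seq (s :: t') -> (size t').+2 = n ->
    {subset s :: t' <= (S `|` B)%fset} -> forall x, x \in (S `|` B)%fset ->
    s.1 < x.1 -> x.1 < (last s t').1 -> slope s (last s t') < slope s x ->
    exists Q : {fset R * R}, [/\ (Q `<=` S `|` B)%fset, #|` Q| = n & convex_position Q].
  move=> ct' st' t'S x xS sx xl lt; have [cQ pQ] := cup_point_convex_position ct' sx xl lt.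
  exists (x |` [fset y in s :: t'])%fset; split=> //; last by rewrite cQ.
  apply/fsubsetP => y; rewrite in_fset1U => /predU1P[-> //|].
  by rewrite in_fset => /t'S.
have sc : s.1 < c.1.
  by apply: (cup_seq_lt_head cupt); rewrite et !(mem_rcons, inE) eqxx orbT.
have [dc cb dcb] : [/\ d.1 < c.1, c.1 < b.1 & slope d c < slope c b].
  move: cupt; rewrite et' cup_seq_rcons3 => /and3P[/andP[+ _] -> ->].
  by rewrite sorted_rcons2 => /andP[].
have sb := lt_trans sc cb.
have pSB := SSB _ pS; have sSB := SSB _ sS.
have size_n : (size t).+2 = n by rewrite sz prednK // (leq_trans _ n4).
have pb_neq : p.1 != b.1.
  apply/eqP => /(proj2 gSB _ _ pSB bS) pb.
  by move/fdisjointP: dis => /(_ _ pS); rewrite pb -eb bB.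
(* p to the left of b: it extends the cup ..., u, s to p, b unless it lies above
   the line sb, in which case it completes the polygon of s :: t. *)
have [pb|bp|/eqP] := ltgtP p.1 b.1; last by rewrite (negPf pb_neq).
  have [spb|spb] := general_position_slope_lt gSB sSB pSB bS sp pb.
    by apply: Or32; exact: (cupm p b).
  apply: Or33; apply: (ngonp t cupt size_n tSB p pSB) => //; rewrite ?eb //.
  by move: spb; have [-> -> _] := slope_gt_turn sp pb.
(* Now [b] is left of [p]. If it lies below the line [sp], either [p] extends [s :: t] to an
   [n]-cup, or [c], [b], [p], [q] is a 4-cap. *)
have [sbp|sbp] := general_position_slope_lt gSB sSB bS pSB sb bp.
  have [cbp|cbp] := general_position_slope_lt gSB cS bS pSB cb bp.
    apply: Or33; apply: (ngon (rcons (s :: t) p)).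
    - by rewrite et' cup_seq_rcons3 -et' cupt bp cbp.
    - by rewrite size_rcons.
    - by move=> x; rewrite mem_rcons inE => /predU1P[->|/tSB].
  apply: Or31; apply: (cap4 c b) => //; apply: lt_trans spq _.
  by move: sbp; have [-> _ ->] := slope_lt_turn sb bp.
(* With [b] above [sp]: if [c] is above the line [us], then [c] and [b] extend the cup ending in
   [u], [s]. *)
have [usc|scu] := ltP (slope u s) (slope s c).
  apply: Or32; apply: (cupm c b) => //.
  have cupc : cup_seq (rcons (rcons l d) c).
    by apply: (@cup_seq_rcons _ b); rewrite -et'.
  have [|_ sdc] := cup_slope_last cupc (x := s); first by rewrite -el mem_head.
  exact: le_lt_trans sdc dcb.
(* Now c is below the line us, hence below sp, while b is above sp: if d, c, p is
   a cup, the cup s, ..., c, p together with b is a convex n-gon. *)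
have cp := lt_trans cb bp.
have scp : slope s p < slope c p.
  have := le_lt_trans scu usp.
  by have [_ -> ->] := slope_lt_turn sc cp.
have [dcp|dcp] := general_position_slope_lt gSB dS cS pSB dc cp; last first.
  (* A right turn at [c] gives the cap [d], [c], [p], [q], since
     [slope p q < slope s p < slope c p]. *)
  by apply: Or31; apply: (cap4 d c) => //; exact: lt_trans scp.
apply: Or33.
have cupp : cup_seq (s :: rcons (rcons t0 c) p).
  rewrite -!rcons_cons el cup_seq_rcons3 cp dcp !andbT.
  by apply: (@cup_seq_rcons _ b); rewrite -et'.
apply: (ngonp _ cupp _ _ b) => //.
- by move: size_n; rewrite et !size_rcons.
- move=> x; rewrite -rcons_cons mem_rcons inE => /predU1P[-> //|xt].
  by apply: tSB; rewrite et -rcons_cons mem_rcons inE xt orbT.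
- by rewrite last_rcons.
- by rewrite last_rcons; move: sbp; have [-> -> _] := slope_gt_turn sb bp.
Qed.

End Slopes.

(** * Choice of the good point by counting *)

Theorem theorem2 (R : realType) (m : nat) (hm : (4 <= m)%N)
    (S : {fset R * R}) (hS : general_position S)
    (hfree : cup_cap_free m 4 S)
    (hcard : ('C(m, 2) - m + 2 < #|` S|)%N) :
  exists s : R * R,
    good m 4 S s /\
    exists t : seq (R * R), is_cap 3 (s :: t) /\ {subset s :: t <= S}.
Proof.
case: m hm hfree hcard => [|[|[|[|m]]]] // _ hfree hcard.
have VS : {subset cap_starters S <= S} by move=> x; rewrite !inE => /andP[].
(* With [m] shifted by 4, Pascal's rule gives ['C(m.+4, 2) = 'C(m.+2, 2) + m.+2 + m.+3]. Subtracting
   [m.+4], adding 2 and losing at most [m.+3] points leaves exactly this bound. *)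
have big : ('C(m.+2, 2) < #|` cap_starters S|)%N.
  have := card_cap_starters hS hfree.
  move: hcard; rewrite 2!(binS _ 1) !bin1; lia.
have free3 := cap_starters_free (k := m.+3) isT hS hfree.
have [l [cl lV]] : exists l, is_cup m.+2 l /\ {subset l <= cap_starters S}.
  apply: contrapT => no; move: big; rewrite ltnNge card_cup_cap4_free //.
    exact: general_position_sub VS hS.
  split; last exact: (proj2 free3).
  by move=> l lV cl; apply: no; exists l.
have [sz _ _] := cl.
have [us [u [s el]]] : exists (us : seq (R * R)) u s, l = rcons (rcons us u) s.
  by apply: seq_rcons2; rewrite sz.
subst l.
have sV : s \in cap_starters S by apply: lV; rewrite mem_rcons mem_head.
have /andP[sS /starts_capP[p [q [pS qS sp pq spq]]]] : (s \in S) && starts_cap S s.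
  by move: sV; rewrite !inE.
exists s; split.
  by apply: (good_of_cup_cap hS (proj2 hfree) cl _ pS qS) => // x /lV /VS.
exists [:: p; q]; split; first exact: is_cap3.
by move=> x; rewrite !inE => /or3P[] /eqP ->.
Qed.
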